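(* For every constant $c>0$ there is a constant $C>0$ such that the following holds. Let $\mathcal{G}=(G_1,\dots,G_T)$ be an always-connected temporal graph on $n$ vertices whose underlying graph $U$ has a $c$-strict $(r,b)$-division, with $r\ge 2$ and $b\ge 1$, and let $\Delta$ be the average degree of $U$. Put \[ f=n r^{0.5}b^{3}\Delta^{1.5}\log^{1.5}(r)+n^{2}/r, \] and suppose $T\ge Cf$. Then $b$ agents, starting at arbitrary given vertices, can visit all vertices of $\mathcal{G}$ using only the snapshots $G_1,\dots,G_{\lceil Cf\rceil}$.
   Context: A temporal graph $\mathcal{G}=(G_1,\dots,G_T)$ on a vertex set $V$, $|V|=n$, is a sequence of simple undirected graphs $G_t=(V,E_t)$. It is always-connected if each $G_t$ is connected. Its underlying graph is $U=(V,\bigcup_tE_t)$, with average degree $\Delta=\frac1n\sum_v\deg_U(v)$. A set $S\subseteq V$ is an $(r,b)$-division of a graph $G=(V,E)$ if $V\setminus S$ can be partitioned into parts (components) $C_1,\dots,C_q$ such that: - every edge of $G$ either lies inside one part, or lies inside $S$, or joins a part to $S$; - each part has at most $r$ vertices; - each part has at most $b$ vertices of $S$ adjacent to it (its boundary vertices). The division is $c$-strict if $q\le c\,n/r$; the paper calls this ''strict'', meaning there are $O(n/r)$ components. A temporal walk is a sequence $((v_0,v_1),t_1),\dots,((v_{\ell-1},v_\ell),t_\ell)$ with $\{v_{j-1},v_j\}\in E_{t_j}$ and $t_1<\dots<t_\ell$. Waiting is allowed, and the walk visits $v_0,\dots,v_\ell$. Each agent follows one temporal walk from its start vertex. *)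

(* Defs.v *)
From HB Require Import structures.
From mathcomp Require Import all_boot all_order all_algebra.
From mathcomp Require Import all_classical all_reals all_analysis.

Set Implicit Arguments.
Unset Strict Implicit.
Unset Printing Implicit Defensive.

Import Order.TTheory GRing.Theory Num.Theory.

Local Open Scope ring_scope.

Record sgraph (V : finType) := SGraph {
  adj : rel V;
  adj_sym : symmetric adj;
  adj_irrefl : irreflexive adj }.

Definition connected_graph (V : finType) (G : sgraph V) : Prop :=
  forall x y : V, connect (adj G) x y.

Definition degree (V : finType) (G : sgraph V) (v : V) : nat :=
  #|[set w : V | adj G v w]|.

Definition average_degree (R : realType) (V : finType) (G : sgraph V) : R :=
  (\sum_(v : V) degree G v)%N%:R / #|V|%:R.

(* The snapshot G_t, for 1 <= t <= T, is the value at the ordinal t - 1. *)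
Definition tgraph (V : finType) (T : nat) := 'I_T -> sgraph V.

Definition always_connected (V : finType) (T : nat) (G : tgraph V T) : Prop :=
  forall t : 'I_T, connected_graph (G t).

Section Underlying.
Variables (V : finType) (T : nat) (G : tgraph V T).

Definition underlying_adj : rel V :=
  fun x y => [exists t : 'I_T, adj (G t) x y].

Lemma underlying_sym : symmetric underlying_adj.
Proof. by move=> x y; apply: eq_existsb => t; rewrite adj_sym. Qed.

Lemma underlying_irrefl : irreflexive underlying_adj.
Proof. by move=> x; apply/existsP => -[t]; rewrite adj_irrefl. Qed.

Definition underlying : sgraph V := SGraph underlying_sym underlying_irrefl.

End Underlying.

Definition boundary (V : finType) (G : sgraph V) (S C : {set V}) : {set V} :=
  [set s in S | [exists x in C, adj G x s]].

(* P is the set of parts; [finset.partition] makes the parts nonempty, pairwise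
   disjoint, and with union V \ S. They need not be connected in G. *)
Definition division_parts (V : finType) (G : sgraph V) (r b : nat)
    (S : {set V}) (P : {set {set V}}) : Prop :=
  [/\ finset.partition P (~: S),
      forall x y : V, adj G x y ->
        [\/ exists2 C, C \in P & (x \in C) && (y \in C),
            (x \in S) && (y \in S) |
            exists2 C, C \in P &
              (x \in C) && (y \in S) || (x \in S) && (y \in C)],
      forall C, C \in P -> (#|C| <= r)%N
    & forall C, C \in P -> (#|boundary G S C| <= b)%N].

Definition strict_division (R : realType) (c : R) (V : finType) (G : sgraph V)
    (r b : nat) (S : {set V}) : Prop :=
  exists2 P : {set {set V}}, division_parts G r b S P
    & #|P|%:R <= c * #|V|%:R / r%:R.

(* The step ((u, v), t) traverses the edge {u, v} of the snapshot at t. *)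
Definition tstep (V : finType) (T : nat) : Type := ((V * V) * 'I_T)%type.

Definition temporal_walk (V : finType) (T : nat) (G : tgraph V T) (v0 : V)
    (w : seq (tstep V T)) : bool :=
  [&& all (fun s : tstep V T => adj (G s.2) s.1.1 s.1.2) w,
      sorted (fun s s' : tstep V T => (s.1.2 == s'.1.1) && (s.2 < s'.2)%N) w
    & head v0 [seq s.1.1 | s <- w] == v0].

Definition visited (V : finType) (T : nat) (v0 : V) (w : seq (tstep V T)) :
    seq V := v0 :: [seq s.1.2 | s <- w].

(* The b agents, agent i starting at [start i], visit all vertices using only
   the first k snapshots; the step index t : 'I_T refers to snapshot t + 1. *)
Definition explorable_within (V : finType) (T : nat) (G : tgraph V T)
    (b : nat) (start : 'I_b -> V) (k : int) : Prop :=
  exists w : 'I_b -> seq (tstep V T),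
    [/\ forall i, temporal_walk G (start i) (w i),
        forall i (s : tstep V T), s \in w i -> Posz (nat_of_ord s.2).+1 <= k
      & forall v : V, exists i, v \in visited (start i) (w i)].

(* The base of the logarithm only affects the multiplicative constant. *)
Definition exploration_bound (R : realType) (n r b : nat) (Delta : R) : R :=
  n%:R * (r%:R `^ (1 / 2)) * b%:R ^+ 3 * (Delta `^ (3 / 2))
    * ((ln r%:R) `^ (3 / 2)) + n%:R ^+ 2 / r%:R.

(* Main.v *)
Require Import Defs.
From mathcomp Require Import all_boot all_order all_algebra.
From mathcomp Require Import all_classical all_reals all_analysis.
From mathcomp Require Import fintype finset zify ring.

Set Implicit Arguments.
Unset Strict Implicit.
Unset Printing Implicit Defensive.

Import Order.TTheory GRing.Theory Num.Theory.

(** A single agent explores an always-connected temporal graph with n vertices whose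
    underlying graph has degree sum E in O(n^(1/3) E) steps, and this is O(f) since
    x^2 y <= (x + y)^3 for the two summands x and y of f.

    Counting argument: let g be a potential on vertices that never increases along
    temporal walks, and let Y be a set of vertices on which g is constant during a
    window of l steps and which do not reach each other at equal potential. At each
    step, every u in Y has an edge of the snapshot leaving the set of vertices from
    which it can still return, and these edges are essentially distinct, so |Y| l is
    at most about twice E plus the weighted drop of g over the window.

    Take as g the number of rounds in which a walk can still collect h new vertices of
    the unvisited set X against an opponent who blocks h^2 vertices in each round. If g
    were below h everywhere, it would be constant on half of X during some window of
    length about h^2 E / |X|; the counting argument, applied in the two parts of the
    window, then yields walks at constant level that the opponent cannot all block, a
    contradiction. Hence about h^3 E / |X| steps suffice to visit h^2 vertices of X.
    With h^3 of the order of |X|, a phase of O(E) steps visits about |X|^(2/3) vertices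
    of X, so O(n^(1/3)) phases visit all vertices. *)

(** * Finite combinatorics *)

Lemma connect_crossing (V : finType) (r : rel V) (K : {set V}) (x y : V) :
  connect r x y -> x \in K -> y \notin K ->
  exists k w, [/\ k \in K, w \notin K & r k w].
Proof.
case/connectP=> p; elim: p x => [|z p IH] x /= => [_ -> -> //|].
move=> /andP[xz zp] yp xK yK; have [zK|zK] := boolP (z \in K); first exact: IH zK yK.
by exists x, z.
Qed.

Lemma exists_subset_card (T : finType) (A : {set T}) (k : nat) :
  k <= #|A| -> exists2 B : {set T}, B \subset A & #|B| = k.
Proof.
rewrite -bin_gt0 -cards_draws => /card_gt0P[B].
by rewrite inE => /andP[BA /eqP Bk]; exists B.
Qed.

Lemma double_counting (I J : finType) (X : {set I}) (Y : {set J}) (r : I -> J -> bool) :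
  \sum_(x in X) #|[set y in Y | r x y]| = \sum_(y in Y) #|[set x in X | r x y]|.
Proof.
under eq_bigr do rewrite -sum1dep_card.
rewrite (exchange_big_dep (mem Y)) /=; last by move=> x y _ /andP[].
apply: eq_bigr => y yY; rewrite -sum1dep_card.
by apply: eq_bigl => x; rewrite yY.
Qed.

Lemma pigeonhole_two_sums (M h1 h2 x1 x2 : nat) (c1 c2 : 'I_M -> nat) :
  0 < M -> h1 + h2 <= M ->
  \sum_i c1 i <= h1 * x1 -> \sum_i c2 i <= h2 * x2 ->
  exists i, c1 i <= x1 /\ c2 i <= x2.
Proof.
move=> M_gt0 h_leq_M sum1 sum2; apply: contrapT => none.
have: \sum_(i < M) x1.+1 * x2.+1 <= \sum_i (x2.+1 * c1 i + x1.+1 * c2 i).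
  apply: leq_sum => i _.
  have [c1x|x1c] := leqP (c1 i) x1; last by nia.
  have [c2x|x2c] := leqP (c2 i) x2; last by nia.
  by case: none; exists i.
rewrite sum_nat_const card_ord big_split -!big_distrr /= => /leq_trans.
move/(_ _ (leq_add (leq_mul (leqnn x2.+1) sum1) (leq_mul (leqnn x1.+1) sum2))).
have := leq_mul h_leq_M (leqnn (x1.+1 * x2.+1)).
have: 0 < M * (x1.+1 * x2.+1) by rewrite !muln_gt0 M_gt0.
have [/eqP|] := posnP (h1 + h2); first by rewrite addn_eq0 => /andP[/eqP-> /eqP->]; lia.
by nia.
Qed.

Lemma exists_floor_root (c k x : nat) : 0 < c -> 0 < k ->
  exists h, c * h ^ k <= x < c * h.+1 ^ k.
Proof.
move=> c_gt0 k_gt0; pose P h := c * h ^ k <= x.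
have some_P : exists h, P h by exists 0; rewrite /P exp0n ?muln0.
have P_bounded h : P h -> h <= x.
  apply: leq_trans; case: h => // h.
  by rewrite -{1}[h.+1]expn1 (leq_trans _ (leq_pmull _ c_gt0)) ?leq_pexp2l.
have [h Ph max_h] := ex_maxnP some_P P_bounded.
by exists h; rewrite [_ <= x]Ph ltnNge; apply/negP => /max_h; rewrite ltnn.
Qed.

Lemma exists_ceil_root (k m : nat) : 0 < k -> 0 < m ->
  exists p, m <= p ^ k <= 2 ^ k * m.
Proof.
move=> k_gt0 m_gt0; have [h] := exists_floor_root m (isT : 0 < 1) k_gt0.
rewrite !mul1n => /andP[h_leq m_lt]; exists h.+1; rewrite (ltnW m_lt) /=.
apply: leq_trans (leq_mul (leqnn _) h_leq); rewrite -expnMn leq_exp2r //.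
by case: h m_lt {h_leq}; [rewrite exp1n; lia|lia].
Qed.

Section SparseDigraph.
Variables (V : finType) (Z : V -> {set V}) (d : nat).

Lemma exists_small_indegree (Y : {set V}) :
  0 < #|Y| -> {in Y, forall u, #|Z u| <= d} ->
  exists2 u, u \in Y & #|[set v in Y | u \in Z v]| <= d.
Proof.
move=> Y_gt0 Zd; apply/exists_inP; apply: contraT => /exists_inPn large.
have: \sum_(u in Y) d.+1 <= \sum_(v in Y) #|[set u in Y | u \in Z v]|.
  rewrite (double_counting Y Y (fun v u => u \in Z v)).
  by apply: leq_sum => u /large; rewrite -ltnNge.
have: \sum_(v in Y) #|[set u in Y | u \in Z v]| <= \sum_(v in Y) d.
  apply: leq_sum => v vY; apply: leq_trans (Zd v vY).
  by apply/subset_leq_card/subsetP => u; rewrite inE => /andP[].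
by rewrite !sum_nat_const; nia.
Qed.

Lemma exists_independent_subset (Y : {set V}) :
  {in Y, forall u, #|Z u| <= d} ->
  exists Y' : {set V}, [/\ Y' \subset Y,
    {in Y' &, forall u u', u != u' -> u' \notin Z u} &
    #|Y| <= (2 * d).+1 * #|Y'|].
Proof.
have [k] := ubnP #|Y|; elim: k Y => // k IH Y Yk Zd.
have [->|[y yY]] := set_0Vmem Y.
  by exists set0; split=> [|u u'|]; rewrite ?sub0set ?inE // cards0.
have [|u uY pred_u] := exists_small_indegree _ Zd; first by apply/card_gt0P; exists y.
pose N := u |: (Z u :|: [set v in Y | u \in Z v]).
have N_small : #|N| <= (2 * d).+1.
  apply: leq_trans (leq_card_setU _ _) _; rewrite cards1 add1n ltnS.
  by apply: leq_trans (leq_card_setU _ _) _; rewrite mul2n -addnn leq_add // Zd.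
have Y_le : #|Y| <= #|N| + #|Y :\: N|.
  by rewrite -(cardsID N Y) leq_add2r subset_leq_card // subsetIr.
have [||Y' [Y'Y indep Y'card]] := IH (Y :\: N).
- rewrite -ltnS; apply: leq_trans Yk; rewrite ltnS proper_card //.
  apply/properP; split; first exact: subsetDl.
  by exists u; rewrite ?inE ?eqxx.
- by move=> v /setDP[vY _]; apply: Zd.
have Y'_avoids v : v \in Y' -> [/\ v != u, v \notin Z u & u \notin Z v].
  move/(subsetP Y'Y); rewrite !inE !negb_or => /andP[/and3P[-> -> uZv] vY].
  by rewrite vY in uZv.
exists (u |: Y'); split.
- by rewrite subUset sub1set uY (subset_trans Y'Y) ?subsetDl.
- move=> v v'; rewrite !inE => /orP[/eqP->|vY'] /orP[/eqP->|vY''].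
  + by rewrite eqxx.
  + by have [] := Y'_avoids _ vY''.
  + by have [] := Y'_avoids _ vY'.
  + exact: indep.
- have uY' : u \notin Y' by apply/negP => /Y'_avoids[]; rewrite eqxx.
  by rewrite cardsU1 uY' /=; nia.
Qed.

End SparseDigraph.

Section BalancedFamilies.
Variables (V : finType) (q : nat).
Hypothesis q_gt0 : 0 < q.

Definition load (X : {set V}) (B : V -> {set V}) (a : V) : nat :=
  #|[set u in X | a \in B u]|.

Lemma sum_load (X Q : {set V}) (B : V -> {set V}) :
  \sum_(a in Q) load X B a = \sum_(u in X) #|B u :&: Q|.
Proof.
rewrite -(double_counting X Q (fun u a => a \in B u)).
by apply: eq_bigr => u _; apply: eq_card => a; rewrite !inE andbC.
Qed.

Lemma card_saturated (X : {set V}) (B : V -> {set V}) :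
  {in X, forall u, #|B u| <= q} -> #|[set a | q <= load X B a]| <= #|X|.
Proof.
move=> Bq; rewrite -(leq_pmul2r q_gt0) -!sum_nat_const.
set sat := [set a | _]; apply: (@leq_trans (\sum_(a in sat) load X B a)).
  by apply: leq_sum => a; rewrite inE.
rewrite sum_load; apply: leq_sum => u uX.
exact: leq_trans (subset_leq_card (subsetIl _ _)) (Bq u uX).
Qed.

Variable plan : V -> {set V} -> Prop.

Definition balanced_family (Y F : {set V}) (B : V -> {set V}) : Prop :=
  [/\ F \subset Y, {in F, forall u, plan u (B u) /\ #|B u| = q} &
      forall a, load F B a <= q].

Lemma balanced_family_extend (Y F : {set V}) (B : V -> {set V}) (u : V) (Bu : {set V}) :
  balanced_family Y F B -> u \in Y :\: F -> plan u Bu -> #|Bu| = q ->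
  {in Bu, forall a, load F B a < q} ->
  exists B', balanced_family Y (u |: F) B'.
Proof.
move=> [FY BF loadF] /setDP[uY uF] planBu Buq loadBu.
exists (fun v => if v == u then Bu else B v); split.
- by rewrite subUset sub1set uY.
- by move=> v; rewrite !inE; case: eqP => [->|_] //= /BF.
- move=> a; have [aBu|aBu] := boolP (a \in Bu).
    apply: leq_trans (loadBu a aBu); rewrite -[_.+1]add1n -(cards1 u).
    apply: leq_trans (leq_card_setU _ _); apply/subset_leq_card/subsetP => v.
    by rewrite !inE; case: eqP.
  apply: leq_trans (loadF a); apply/subset_leq_card/subsetP => v; rewrite !inE.
  by case: eqP => [->|] //=; rewrite (negbTE aBu).
Qed.

Lemma balanced_family0 (Y : {set V}) : balanced_family Y set0 (fun=> set0).
Proof.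
split=> [|u|a]; rewrite ?sub0set ?inE // /load.
by rewrite (_ : [set _ in _ | _] = set0) ?cards0 //; apply/setP => u; rewrite !inE.
Qed.

Lemma exists_balanced_family (Y : {set V}) :
  (forall Y' : {set V}, Y' \subset Y -> #|Y| <= 2 * #|Y'| ->
    exists u (B : {set V}), [/\ u \in Y', B \subset Y', #|B| = q & plan u B]) ->
  exists F B, balanced_family Y F B /\ #|Y| <= 4 * #|F|.
Proof.
move=> plans.
pose P k := `[< exists F B, balanced_family Y F B /\ #|F| = k >].
have some_P : exists k, P k.
  exists 0; apply/asboolP; exists set0, (fun=> set0).
  by split; [exact: balanced_family0|exact: cards0].
have P_bounded k : P k -> k <= #|Y|.
  by move/asboolP=> [F [B [[FY _ _] <-]]]; apply: subset_leq_card.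
have [k /asboolP[F [B [bal Fk]]] k_max] := ex_maxnP some_P P_bounded.
exists F, B; split=> //; rewrite leqNgt; apply/negP => small.
have [FY BF _] := bal.
pose sat := [set a | q <= load F B a]; pose Y' := Y :\: F :\: sat.
have sat_small : #|sat| <= #|F| by apply: card_saturated => u /BF[_ ->].
have [||u [Bu [uY' BuY' Buq planBu]]] := plans Y'.
- exact: subset_trans (subsetDl _ _) (subsetDl _ _).
- have := subset_leq_card (subsetIr Y F).
  have := subset_leq_card (subsetIr (Y :\: F) sat).
  by have := cardsID F Y; have := cardsID sat (Y :\: F); rewrite -/Y'; lia.
have [uYF _] := setDP uY'.
have [a aBu|B' bal'] := balanced_family_extend bal uYF planBu Buq.
  by move: (subsetP BuY' a aBu); rewrite !inE -ltnNge => /andP[].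
have: P k.+1.
  apply/asboolP; exists (u |: F), B'; split=> //.
  by rewrite cardsU1 Fk; case/setDP: uYF => _ ->.
by move/k_max; rewrite ltnn.
Qed.

End BalancedFamilies.

Lemma card_spoiled (V : finType) (h k q m : nat) (F Q : {set V}) (B : V -> {set V}) :
  {in F, forall u, h + k <= #|B u|} -> (forall a, load F B a <= q) -> #|Q| <= m ->
  #|[set u in F | #|B u :\: Q| < h]| * k <= m * q.
Proof.
move=> B_large load_leq Qm; rewrite -sum_nat_const.
apply: (@leq_trans (\sum_(u in F) #|B u :&: Q|)).
  rewrite [X in _ <= X](big_setID [set u | #|B u :\: Q| < h]) /=.
  apply: leq_trans (leq_addr _ _); rewrite -setIdE; apply: leq_sum => u.
  by rewrite inE => /andP[/B_large]; have := cardsID Q (B u); lia.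
rewrite -sum_load; apply: leq_trans (leq_sum _ (fun a _ => load_leq a)) _.
by rewrite sum_nat_const leq_mul2r Qm orbT.
Qed.

Section LargestUpto.
Variable H : nat.

Definition largest_upto (P : nat -> Prop) : nat := \max_(j < H.+1 | `[< P j >]) j.

Lemma largest_upto_leq (P : nat -> Prop) : largest_upto P <= H.
Proof. by apply/bigmax_leqP => j _; rewrite -ltnS. Qed.

Lemma leq_largest_upto (P : nat -> Prop) (j : nat) : P j -> j <= H -> j <= largest_upto P.
Proof.
move=> Pj jH; apply: (@leq_bigmax_cond _ _ _ (Ordinal (jH : j < H.+1))).
exact/asboolP.
Qed.

Lemma largest_upto_sat (P : nat -> Prop) : P 0 -> P (largest_upto P).
Proof.
move=> P0; have some_j : 0 < #|[pred j : 'I_H.+1 | `[< P j >]]|.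
  by apply/card_gt0P; exists ord0; apply/asboolP.
have [j /asboolP Pj max_j] := eq_bigmax_cond (fun j : 'I_H.+1 => nat_of_ord j) some_j.
by rewrite /largest_upto max_j.
Qed.

Lemma largest_upto_not_succ (P : nat -> Prop) :
  largest_upto P < H -> ~ P (largest_upto P).+1.
Proof. by move=> ltH PS; have := leq_largest_upto PS ltH; rewrite ltnn. Qed.

Lemma largest_upto_mono (P P' : nat -> Prop) :
  P 0 -> (forall j, P j -> P' j) -> largest_upto P <= largest_upto P'.
Proof.
move=> P0 PP'.
exact: leq_largest_upto (PP' _ (largest_upto_sat P0)) (largest_upto_leq P).
Qed.

End LargestUpto.

(** * Arithmetic of the phases *)

(* The factor K for which 3 (24 c k)^2 = K k^2 and 8 c K k^3 = (24 c k)^3. *)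
Definition phase_factor (c : nat) : nat := 3 * (24 * c) ^ 2.

Lemma phase_factor_gt0 (c : nat) : 0 < c -> 0 < phase_factor c.
Proof. by move=> c_gt0; rewrite muln_gt0 expn_gt0 muln_gt0 c_gt0. Qed.

(* With K = phase_factor c and x unvisited vertices, a phase visiting d of them decreases
   K x by at least 3 (p + 1)^2, so that about the cube root of K x phases are needed. *)
Lemma phase_factor_decrease (c x p h d : nat) :
  0 < d -> h ^ 2 <= d -> x < c * h.+1 ^ 3 ->
  p ^ 3 < phase_factor c * x <= p.+1 ^ 3 -> phase_factor c * (x - d) <= p ^ 3.
Proof.
rewrite /phase_factor; set K := 3 * _ => d_gt0 h_leq_d x_lt /andP[p_lt x_leq].
pose k := maxn 1 h; pose z := 24 * c.
have k_leq_d : k ^ 2 <= d by rewrite /k /maxn; case: ifP.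
have h_leq_k : h.+1 ^ 3 <= 8 * k ^ 3.
  by rewrite -[8]/(2 ^ 3) -expnMn leq_exp2r // /k; lia.
have p_lt_zk : p < z * k.
  rewrite -(@ltn_exp2r _ _ 3) // (leq_trans p_lt) //.
  have -> : (z * k) ^ 3 = K * (c * (8 * k ^ 3)).
    by rewrite /K -/z expnMn expnSr {2}/z; lia.
  by rewrite leq_mul2l (leq_trans (ltnW x_lt)) ?leq_mul2l ?h_leq_k !orbT.
have cube_step : p.+1 ^ 3 <= p ^ 3 + 3 * p.+1 ^ 2 by rewrite !expnS !expn0; lia.
have step_leq : 3 * p.+1 ^ 2 <= K * d.
  apply: (@leq_trans (3 * (z * k) ^ 2)); first by rewrite leq_mul2l leq_exp2r.
  by rewrite /K -/z expnMn mulnA leq_mul2l k_leq_d orbT.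
by rewrite mulnBr leq_subLR addnC; lia.
Qed.

Lemma exists_window_lengths (E x h : nat) :
  0 < h -> 200 * 100 * h ^ 3 <= x -> x <= E ->
  exists l1 l2, [/\ l1 <= 2 * E, l2 <= 2 * E, 32 * ((4 * h ^ 2).+1 * E) < x * l1,
    32 * ((4 * h).+1 * E) < x * l2 & 3 * h * (l1 + 10 * h * l2) <= E].
Proof.
move=> h_gt0 x_large xE; pose l1 := E %/ (6 * h); pose l2 := E %/ (60 * h ^ 2).
have h2_gt0 : 0 < h ^ 2 by rewrite expn_gt0 h_gt0.
have h_leq_h2 : h <= h ^ 2 by rewrite -{1}[h]expn1 leq_pexp2l.
have E_large : 200 * 100 * h ^ 2 <= E.
  by apply: leq_trans xE; apply: leq_trans x_large; rewrite leq_mul2l leq_pexp2l.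
have l1_large : E <= 12 * h * l1.
  by have := ltn_ceil E (_ : 0 < 6 * h); rewrite -/l1; lia.
have l2_large : E <= 120 * h ^ 2 * l2.
  by have := ltn_ceil E (_ : 0 < 60 * h ^ 2); rewrite -/l2; lia.
have x_scaled (k a l : nat) : 0 < k -> k * a < k * (200 * 100 * h ^ 3 * l) -> a < x * l.
  move=> k_gt0; rewrite ltn_pmul2l // => /leq_trans; apply.
  by rewrite leq_mul2r x_large orbT.
exists l1, l2; split.
- exact: leq_trans (leq_div _ _) (leq_pmull _ _).
- exact: leq_trans (leq_div _ _) (leq_pmull _ _).
- by apply: (x_scaled 12) => //; rewrite expnSr; nia.
- by apply: (x_scaled 120) => //; rewrite expnSr; nia.
- have := leq_divM E (6 * h); have := leq_divM E (60 * h ^ 2); rewrite -/l1 -/l2.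
  by rewrite expnS expn1; lia.
Qed.

(** * Routes and potentials *)

Section Routes.
Variables (V : finType) (A : nat -> rel V).

(* From u at time s; the k-th vertex of p is the position at time s + k + 1. *)
Fixpoint route (s : nat) (u : V) (p : seq V) : bool :=
  if p is v :: p' then ((v == u) || A s u v) && route s.+1 v p' else true.

Lemma route_cat (s : nat) (u : V) (p p' : seq V) :
  route s u (p ++ p') = route s u p && route (s + size p) (last u p) p'.
Proof.
by elim: p s u => [|v p IH] s u /=; rewrite ?addn0 // IH addSnnS andbA.
Qed.

Definition tour (s : nat) (u : V) (t : nat) (w : V) (B : {set V}) : Prop :=
  exists p, [/\ route s u p, s + size p = t, last u p = w & {subset B <= u :: p}].

Definition reachable (s : nat) (u : V) (t : nat) (w : V) : Prop := tour s u t w set0.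

Lemma tour_subset (s t : nat) (u w : V) (B B' : {set V}) :
  B' \subset B -> tour s u t w B -> tour s u t w B'.
Proof. by move=> /subsetP B'B [p [? ? ? Bp]]; exists p; split=> // a /B'B/Bp. Qed.

Lemma tour_reachable (s t : nat) (u w : V) (B : {set V}) :
  tour s u t w B -> reachable s u t w.
Proof. exact/tour_subset/sub0set. Qed.

Lemma tour_wait (s t : nat) (u : V) : s <= t -> tour s u t u [set u].
Proof.
move=> st; exists (nseq (t - s) u); split; last by move=> a /set1P->; apply: mem_head.
- by move: (t - s) => k; elim: k s {st} => //= k IH s; rewrite eqxx IH.
- by rewrite size_nseq subnKC.
- by elim: (t - s) => //= k <-; case: k.
Qed.

Lemma tour_cat (t : nat) (v : V) (s r : nat) (u w : V) (B B' : {set V}) :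
  tour s u t v B -> tour t v r w B' -> tour s u r w (B :|: B').
Proof.
move=> [p [up <- <- Bp]] [p' [pp' <- <- Bp']]; exists (p ++ p'); split.
- by rewrite route_cat up.
- by rewrite size_cat addnA.
- by rewrite last_cat.
- move=> a; rewrite inE -cat_cons mem_cat => /orP[/Bp-> //|/Bp'].
  by rewrite inE => /orP[/eqP->|->]; rewrite ?mem_last ?orbT.
Qed.

Lemma reachable_wait (s t : nat) (u : V) : s <= t -> reachable s u t u.
Proof. by move/(tour_wait u)/tour_reachable. Qed.

Lemma reachable_step (t : nat) (u w : V) : (w == u) || A t u w -> reachable t u t.+1 w.
Proof. by move=> uw; exists [:: w]; rewrite /= uw addn1; split=> // a; rewrite inE. Qed.

Lemma reachable_tour (t : nat) (v : V) (s r : nat) (u w : V) (B : {set V}) :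
  reachable s u t v -> tour t v r w B -> tour s u r w B.
Proof. by move=> uv vw; rewrite -[B]set0U; apply: tour_cat uv vw. Qed.

Lemma tour_extend (t r : nat) (s : nat) (u w : V) (B : {set V}) :
  tour s u t w B -> t <= r -> tour s u r w B.
Proof.
by move=> uw tr; rewrite -[B]setU0; apply: tour_cat uw (reachable_wait _ tr).
Qed.

Lemma reachable_trans (t : nat) (v : V) (s r : nat) (u w : V) :
  reachable s u t v -> reachable t v r w -> reachable s u r w.
Proof. exact: reachable_tour. Qed.

Definition potential (g : nat -> V -> nat) : Prop :=
  forall t v w, (w == v) || A t v w -> g t.+1 w <= g t v.

Lemma potential_reachable (g : nat -> V -> nat) (s t : nat) (u w : V) :
  potential g -> reachable s u t w -> g t w <= g s u.
Proof.
move=> g_pot [p [up <- <- _]]; elim: p s u up => [|v p IH] s u /=; first by rewrite addn0.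
case/andP=> uv /IH; rewrite addSnnS => /leq_trans; apply; exact: g_pot.
Qed.

Lemma potential_wait (g : nat -> V -> nat) (s t : nat) (v : V) :
  potential g -> s <= t -> g t v <= g s v.
Proof. by move=> g_pot /(reachable_wait v); apply: potential_reachable. Qed.

Definition steady (g : nat -> V -> nat) (s t : nat) : {set V} := [set u | g t u == g s u].

Lemma steady_value (g : nat -> V -> nat) (s t r : nat) (u : V) :
  potential g -> u \in steady g s t -> s <= r <= t -> g r u = g s u.
Proof.
move=> g_pot; rewrite inE => /eqP gu /andP[sr rt]; apply/eqP.
by rewrite eqn_leq potential_wait //= -gu potential_wait.
Qed.

Lemma steady_subwindow (g : nat -> V -> nat) (s t s' t' : nat) :
  potential g -> s <= s' -> s' <= t' -> t' <= t -> steady g s t \subset steady g s' t'.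
Proof.
move=> g_pot ss' s't' t't; apply/subsetP=> u gu; rewrite inE.
by rewrite !(steady_value g_pot gu) ?ss' ?t't ?(leq_trans ss') // (leq_trans s't').
Qed.

Definition weighted_drop (a : V -> nat) (g : nat -> V -> nat) (s t : nat) : nat :=
  \sum_w a w * (g s w - g t w).

Lemma weighted_drop_subwindow (a : V -> nat) (g : nat -> V -> nat) (s t s' t' : nat) :
  potential g -> s <= s' -> t' <= t -> weighted_drop a g s' t' <= weighted_drop a g s t.
Proof.
move=> g_pot ss' t't; apply: leq_sum => w _; rewrite leq_mul2l.
by apply/orP; right; apply: leq_sub; apply: potential_wait.
Qed.

Lemma sum_weighted_drop (a : V -> nat) (g : nat -> V -> nat) (s l M : nat) :
  potential g ->
  \sum_(i < M) weighted_drop a g (s + i * l) (s + i * l + l) =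
  weighted_drop a g s (s + M * l).
Proof.
move=> g_pot; rewrite exchange_big /=; apply: eq_bigr => w _; rewrite -big_distrr /=.
congr (_ * _); elim: M => [|M IH]; first by rewrite big_ord0 addn0 subnn.
rewrite big_ord_recr /= IH mulSnr addnA.
have := potential_wait w g_pot (leq_addr (M * l) s).
by have := potential_wait w g_pot (leq_addr l (s + M * l)); lia.
Qed.

Lemma card_unsteady (g : nat -> V -> nat) (Y : {set V}) (s t : nat) :
  potential g -> s <= t -> #|Y :\: steady g s t| <= weighted_drop (fun u => u \in Y) g s t.
Proof.
move=> g_pot st; rewrite -sum1_card big_mkcond; apply: leq_sum => u _; rewrite !inE.
case: eqP => //= ne; case: (u \in Y) => //.
by rewrite mul1n subn_gt0 ltn_neqAle potential_wait // andbT; apply/eqP.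
Qed.

Lemma exists_quiet_window (g : nat -> V -> nat) (a : V -> nat) (Y : {set V})
    (s l M h h' : nat) :
  potential g -> 0 < M -> 2 * h + h' <= M ->
  {in Y, forall u, g s u - g (s + M * l) u <= h} ->
  weighted_drop a g s (s + M * l) <= h' * \sum_w a w ->
  exists t, [/\ s <= t, t + l <= s + M * l, #|Y| <= 2 * #|Y :&: steady g t (t + l)| &
    weighted_drop a g t (t + l) <= \sum_w a w].
Proof.
move=> g_pot M_gt0 h_leq_M dropY dropV.
pose start (i : 'I_M) := s + i * l.
have [||i [Yi Vi]] := @pigeonhole_two_sums M (2 * h) h' #|Y| (\sum_w a w)
    (fun i => 2 * weighted_drop (fun u => u \in Y) g (start i) (start i + l))
    (fun i => weighted_drop a g (start i) (start i + l)) M_gt0 h_leq_M; last first.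
- exists (start i); split=> //; first exact: leq_addr.
    by rewrite -addnA leq_add2l addnC -mulSn leq_mul2r ltn_ord orbT.
  have := card_unsteady Y g_pot (leq_addr l (start i)).
  by have := cardsID (steady g (start i) (start i + l)) Y; lia.
- by rewrite sum_weighted_drop.
- rewrite -big_distrr /= sum_weighted_drop // -mulnA leq_mul2l /= [h * _]mulnC.
  rewrite -sum_nat_const [X in _ <= X]big_mkcond; apply: leq_sum => u _.
  by case: ifP => // /dropY; rewrite mul1n.
Qed.

End Routes.

Section Refinement.
Variables (V : finType) (A : nat -> rel V) (q : nat) (lam depth : nat -> V -> nat).
Hypothesis lam_pot : potential A lam.
Hypothesis depth_leq : forall t v, depth t v <= q.

Definition refine (t : nat) (v : V) : nat := q.+1 * lam t v + depth t v.

Lemma refine_inj (t t' : nat) (v v' : V) :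
  refine t v = refine t' v' -> lam t v = lam t' v' /\ depth t v = depth t' v'.
Proof.
have lamE r w : refine r w %/ q.+1 = lam r w.
  by rewrite /refine mulnC divnMDl // divn_small ?addn0 // ltnS.
move=> eq_refine; have eq_lam : lam t v = lam t' v' by rewrite -!lamE eq_refine.
by split=> //; move: eq_refine; rewrite /refine eq_lam => /addnI.
Qed.

Lemma refine_potential :
  (forall t v w, (w == v) || A t v w -> lam t.+1 w = lam t v ->
    depth t.+1 w <= depth t v) ->
  potential A refine.
Proof.
move=> depth_mono t v w vw; have := lam_pot vw; rewrite /refine leq_eqVlt.
case/orP => [/eqP eq_lam | lt_lam]; last by have := depth_leq t.+1 w; nia.
by rewrite eq_lam leq_add2l depth_mono.
Qed.

Lemma weighted_drop_refine (a : V -> nat) (s t : nat) : s <= t ->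
  weighted_drop a refine s t <= q.+1 * weighted_drop a lam s t + q * \sum_w a w.
Proof.
move=> st; rewrite !big_distrr -big_split /=; apply: leq_sum => w _.
have := depth_leq s w; have := potential_wait w lam_pot st; rewrite /refine.
by rewrite mulnCA [q * _]mulnC -mulnDr leq_mul2l mulnBr; lia.
Qed.

End Refinement.

(** * Robust tours *)

Section RobustTours.
Variables (V : finType) (A : nat -> rel V) (goal : nat -> V -> Prop).
Variables (X : {set V}) (m h f : nat).

(* From v at time t, at least h new vertices of X can be collected j times in
   succession, reaching the goal by time f, whichever m vertices an opponent declares
   to be old before each of the j rounds. *)
Fixpoint robust (j t : nat) (v : V) : Prop :=
  if j is j'.+1 then
    forall Q : {set V}, #|Q| <= m -> exists t' w (B : {set V}),
      [/\ t' <= f, tour A t v t' w B, B \subset X, h <= #|B :\: Q| & robust j' t' w]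
  else goal t v.

Lemma not_robustS (j t : nat) (v : V) : ~ robust j.+1 t v ->
  exists2 Q : {set V}, #|Q| <= m &
    forall t' w (B : {set V}), t' <= f -> tour A t v t' w B -> B \subset X ->
      robust j t' w -> #|B :\: Q| < h.
Proof.
move=> not_robust; apply: contrapT => no_Q; apply: not_robust => Q Qm.
apply: contrapT => stuck; apply: no_Q; exists Q => // t' w B t'f vw BX w_robust.
by rewrite ltnNge; apply/negP => h_le; apply: stuck; exists t', w, B.
Qed.

Hypothesis goal_reachable :
  forall t v t' w, reachable A t v t' w -> goal t' w -> goal t v.

Lemma robust_reachable (j t t' : nat) (v w : V) :
  reachable A t v t' w -> robust j t' w -> robust j t v.
Proof.
case: j => [|j] vw; first exact: goal_reachable vw.
move=> w_robust Q /w_robust[r [x [B [rf wx BX Bh x_robust]]]].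
by exists r, x, B; split=> //; apply: reachable_tour vw wx.
Qed.

Lemma robust_leq (i j t : nat) (v : V) : i <= j -> robust j t v -> robust i t v.
Proof.
elim: j => [|j IH]; first by rewrite leqn0 => /eqP->.
rewrite leq_eqVlt => /orP[/eqP-> // | ij] v_robust; apply: IH => //.
have [|t' [w [B [_ vw _ _]]]] := v_robust set0; first by rewrite cards0.
exact: robust_reachable (tour_reachable vw).
Qed.

Lemma robust_tour (j t : nat) (v : V) (Q : {set V}) :
  robust j t v -> t <= f ->
  exists t' w (B : {set V}), [/\ t' <= f, tour A t v t' w B, B \subset X, goal t' w &
    minn m (#|Q| + j * h) <= #|Q :|: B|].
Proof.
elim: j t v Q => [|j IH] t v Q v_robust tf.
  exists t, v, set0; split; rewrite ?sub0set ?setU0 ?addn0 ?geq_minr //.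
  exact: reachable_wait.
have [Qm | /ltnW mQ] := leqP #|Q| m; last first.
  exists t, v, set0; split; rewrite ?sub0set ?setU0 ?geq_min ?mQ //.
  - exact: reachable_wait.
  - exact: robust_leq (leq0n _) v_robust.
have [t1 [w1 [B1 [t1f vw1 B1X B1h w1_robust]]]] := v_robust Q Qm.
have [t2 [w2 [B2 [t2f w12 B2X w2_goal B2h]]]] := IH _ _ (Q :|: B1) w1_robust t1f.
exists t2, w2, (B1 :|: B2); split=> //; first exact: tour_cat vw1 w12.
  by rewrite subUset B1X.
rewrite setUA; apply: leq_trans B2h.
have : #|Q :|: B1| = #|Q| + #|B1 :\: Q| by rewrite -(cardsID Q) setUK setDUl setDv set0U.
by lia.
Qed.

End RobustTours.

(** * The counting argument *)

Section ExitEdges.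
Variables (V : finType) (A : nat -> rel V) (s f : nat).
Hypothesis A_sym : forall t, symmetric (A t).

Definition return_set (u : V) (t : nat) : {set V} :=
  [set w | `[< reachable A s u t w /\ reachable A t.+1 w f u >]].

Lemma return_setP (u w : V) (t : nat) :
  reflect (reachable A s u t w /\ reachable A t.+1 w f u) (w \in return_set u t).
Proof. by rewrite inE; apply: asboolP. Qed.

Definition exit_edge (u : V) (t : nat) (k w : V) : Prop :=
  [/\ A t k w, k \in return_set u t & w \notin return_set u t].

Lemma exists_exit_edge (u y : V) (t : nat) :
  connect (A t) u y -> s <= t < f -> y \notin return_set u t ->
  exists k w, exit_edge u t k w.
Proof.
move=> t_conn /andP[st tf] yK.
have uK : u \in return_set u t by apply/return_setP; split; apply: reachable_wait.
by have [k [w [kK wK kw]]] := connect_crossing t_conn uK yK; exists k, w.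
Qed.

Lemma exit_edge_from (u k w : V) (t : nat) : exit_edge u t k w -> reachable A s u t.+1 w.
Proof.
case=> kw /return_setP[uk _] _; apply: reachable_trans uk (reachable_step _).
by rewrite kw orbT.
Qed.

Lemma exit_edge_back (u k w : V) (t : nat) : exit_edge u t k w -> reachable A t w f u.
Proof.
case=> kw /return_setP[_ ku] _; apply: reachable_trans (reachable_step _) ku.
by rewrite A_sym kw orbT.
Qed.

Lemma exit_edge_potential (g : nat -> V -> nat) (u k w : V) (t : nat) :
  potential A g -> s <= t < f -> u \in steady g s f -> exit_edge u t k w ->
  g f w <= g s u <= g s w.
Proof.
move=> g_pot /andP[st tf] gu uw; apply/andP; split.
  apply: leq_trans (potential_wait w g_pot tf) _.
  exact: potential_reachable g_pot (exit_edge_from uw).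
rewrite -(steady_value g_pot gu (r := f)) ?leqnn ?(leq_trans st) ?(ltnW tf) //.
apply: leq_trans (potential_reachable g_pot (exit_edge_back uw)) _.
exact: potential_wait g_pot st.
Qed.

Lemma exit_edge_common_tail (u u' k w w' : V) (t t' : nat) : t <= t' ->
  exit_edge u t k w -> exit_edge u' t' k w' -> reachable A s u f u'.
Proof.
move=> tt' [_ /return_setP[uk _] _] [_ /return_setP[_ ku'] _].
by apply: reachable_trans uk (reachable_trans (reachable_wait _ _ _) ku'); apply: leqW.
Qed.

Lemma exit_edge_time_inj (u k k' w : V) (t t' : nat) :
  exit_edge u t k w -> exit_edge u t' k' w ->
  `[< reachable A s u t w >] = `[< reachable A s u t' w >] -> t = t'.
Proof.
wlog: t t' k k' / t <= t' => [wlog_le|].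
  have [tt' | /ltnW t't] := leqP t t'; first exact: wlog_le.
  by move=> uw uw' /esym flag; rewrite (wlog_le _ _ _ _ t't uw' uw flag).
rewrite leq_eqVlt => /orP[/eqP // | tt'] uw uw' flag.
case: (uw) => _ _ /negP[]; apply/return_setP; split.
  apply/asboolP; rewrite flag; apply/asboolP.
  exact: reachable_trans (exit_edge_from uw) (reachable_wait _ _ tt').
exact: reachable_trans (reachable_wait _ _ tt') (exit_edge_back uw').
Qed.

End ExitEdges.

Definition degree_sum (V : finType) (G : sgraph V) : nat := \sum_v degree G v.

Section AlwaysConnected.
Variables (V : finType) (A : nat -> rel V) (U : sgraph V).
Hypothesis A_sym : forall t, symmetric (A t).
Hypothesis A_conn : forall t x y, connect (A t) x y.
Hypothesis A_sub : forall t, subrel (A t) (adj U).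

Local Notation E := (degree_sum U).

Section Counting.
Variables (g : nat -> V -> nat) (s l : nat) (Y : {set V}).
Hypothesis g_pot : potential A g.
Hypothesis Y_steady : Y \subset steady g s (s + l).

Definition level_independent : Prop :=
  {in Y &, forall u u', u != u' -> g s u = g s u' -> ~ reachable A s u (s + l) u'}.

Lemma level_independent_not_return (u u' : V) (t : nat) :
  level_independent -> s <= t < s + l -> u \in Y -> u' \in Y -> u != u' ->
  u' \notin return_set A s (s + l) u t.
Proof.
move=> indep /andP[st tf] uY u'Y uu'; apply/negP => /return_setP[uu't u'tu].
have reach_uu' : reachable A s u (s + l) u'.
  exact: reachable_trans uu't (reachable_wait _ _ (ltnW tf)).
have reach_u'u : reachable A s u' (s + l) u.
  by apply: reachable_trans (reachable_wait _ _ _) u'tu; apply: leqW.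
apply: (indep u u') => //; apply/eqP; rewrite eqn_leq.
have level v : v \in Y -> g (s + l) v = g s v.
  by move/(subsetP Y_steady); rewrite inE => /eqP.
by rewrite -{1}(level u) // -{2}(level u') // !(potential_reachable g_pot).
Qed.

(* For a given w, the pair (u, i) is determined by the other end of its exit edge, by the
   level of u, which lies between the extreme values of g at w, and by whether w had been
   reached from u before. *)
Lemma card_charges (edge : V * 'I_l -> V * V) (w : V) :
  level_independent ->
  {in Y, forall u (i : 'I_l),
    exit_edge A s (s + l) u (s + i) (edge (u, i)).1 (edge (u, i)).2} ->
  #|[set d in setX Y [set: 'I_l] | (edge d).2 == w]| <=
    2 * (degree U w * (g s w - g (s + l) w).+1).
Proof.
move=> indep edgeP; set D := [set d in _ | _].
have exitD d : d \in D -> d.1 \in Y /\ exit_edge A s (s + l) d.1 (s + d.2) (edge d).1 w.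
  by case: d => u i; rewrite !inE andbT => /andP[/= uY /eqP <-]; split=> //; apply: edgeP.
have levelD d : d \in D -> g (s + l) w <= g s d.1 <= g s w.
  move=> /exitD[dY dw]; apply: exit_edge_potential g_pot _ (subsetP Y_steady _ dY) dw => //.
  by rewrite leq_addr ltn_add2l ltn_ord.
pose code (d : V * 'I_l) : bool * V * 'I_(g s w - g (s + l) w).+1 :=
  (`[< reachable A s d.1 (s + d.2) w >], (edge d).1, inord (g s d.1 - g (s + l) w)).
have code_inj : {in D &, injective code}.
  move=> [u i] [u' i'] dD d'D [flag ends levels]; rewrite /= in flag ends levels.
  have [[/= uY uw] [/= u'Y u'w]] := (exitD _ dD, exitD _ d'D).
  have g_uu' : g s u = g s u'.
    have /= level_u := levelD _ dD; have /= level_u' := levelD _ d'D.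
    by move: (congr1 val levels) => /=; rewrite !inordK; lia.
  have uu' : u = u'.
    apply: contrapT => /eqP uu'; rewrite -ends in u'w.
    have [ii' | /ltnW i'i] := leqP (s + i) (s + i').
      exact: (indep _ _ uY u'Y uu' g_uu') (exit_edge_common_tail ii' uw u'w).
    apply: (indep _ _ u'Y uY); rewrite 1?eq_sym //.
    exact: exit_edge_common_tail i'i u'w uw.
  subst u'; congr (_, _); apply/val_inj/(@addnI s).
  exact: exit_edge_time_inj uw u'w flag.
rewrite -(card_in_imset code_inj).
apply: (@leq_trans #|setX (setX [set: bool] [set k | adj U w k]) setT|).
  apply/subset_leq_card/subsetP=> _ /imsetP[d /exitD[_ [kw _ _]] ->].
  by rewrite !inE andbT adj_sym; apply: A_sub kw.
by rewrite !cardsX !cardsT card_bool card_ord -mulnA.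
Qed.

Lemma level_independent_bound :
  level_independent -> 1 < #|Y| ->
  #|Y| * l <= 2 * (weighted_drop (degree U) g s (s + l) + E).
Proof.
move=> indep Y_gt1.
have other u : exists2 u', u' \in Y & u != u'.
  have: 0 < #|Y :\ u| by have := cardsD1 u Y; case: (u \in Y); lia.
  by case/card_gt0P=> u'; rewrite !inE eq_sym => /andP[? ?]; exists u'.
have /choice[edge edgeP] (d : V * 'I_l) : exists kw : V * V,
    d.1 \in Y -> exit_edge A s (s + l) d.1 (s + d.2) kw.1 kw.2.
  have [uY|] := boolP (d.1 \in Y); last by exists (d.1, d.1).
  have [u' u'Y uu'] := other d.1.
  have window : s <= s + d.2 < s + l by rewrite leq_addr ltn_add2l ltn_ord.
  have u'K := level_independent_not_return indep window uY u'Y uu'.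
  by have [k [w kw]] := exists_exit_edge (A_conn _ _ _) window u'K; exists (k, w).
have <- : #|setX Y [set: 'I_l]| = #|Y| * l by rewrite cardsX cardsT card_ord.
rewrite -sum1_card (partition_big (fun d => (edge d).2) xpredT) //=.
rewrite -big_split big_distrr /=; apply: leq_sum => w _.
rewrite sum1dep_card addnC -mulnS; apply: card_charges indep _ => u uY i.
exact: edgeP (u, i) uY.
Qed.

End Counting.

Section Conflicts.
Variables (g : nat -> V -> nat) (s l : nat) (Y : {set V}).
Hypothesis g_pot : potential A g.
Hypothesis Y_steady : Y \subset steady g s (s + l).
Hypothesis l_bound : l <= 2 * E.
Hypothesis g_drop : weighted_drop (degree U) g s (s + l) <= E.

Lemma sparse_conflict_bound (Z : V -> {set V}) (d : nat) :
  {in Y, forall u, #|Z u| <= d} ->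
  {in Y &, forall u u', g s u = g s u' -> reachable A s u (s + l) u' -> u' \in Z u} ->
  #|Y| * l <= (2 * d).+1 * (4 * E).
Proof.
move=> Zd YZ; have [Y' [Y'Y indep Y'card]] := exists_independent_subset Zd.
suff: #|Y'| * l <= 4 * E by move: Y'card; nia.
have [Y'_leq1 | Y'_gt1] := leqP #|Y'| 1; first by nia.
have level_indep : level_independent g s l Y'.
  move=> u u' uY' u'Y' uu' g_uu' reach_uu'.
  by move: (indep u u' uY' u'Y' uu'); rewrite YZ ?(subsetP Y'Y).
have Y'_steady := subset_trans Y'Y Y_steady.
have := level_independent_bound g_pot Y'_steady level_indep Y'_gt1.
by lia.
Qed.

(* B u stands for the vertices that u can collect after the window, and Q for the choice
   of an opponent that keeps u at its level. *)
Lemma stuck_bound (B : V -> {set V}) (m h d : nat) :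
  (forall Q : {set V}, #|Q| <= m -> #|[set u in Y | #|B u :\: Q| < h]| <= d) ->
  {in Y, forall u, exists2 Q : {set V}, #|Q| <= m &
    {in Y, forall u', g s u = g s u' -> reachable A s u (s + l) u' -> #|B u' :\: Q| < h}} ->
  #|Y| * l <= (2 * d).+1 * (4 * E).
Proof.
move=> spoiled stuck.
have /choice[Q QP] u : exists Q : {set V}, u \in Y -> #|Q| <= m /\
    {in Y, forall u', g s u = g s u' -> reachable A s u (s + l) u' -> #|B u' :\: Q| < h}.
  by have [/stuck[Q ? ?]|_] := boolP (u \in Y); [exists Q|exists set0].
apply: (@sparse_conflict_bound (fun u => [set u' in Y | #|B u' :\: Q u| < h])).
  by move=> u /QP[Qm _]; apply: spoiled.
by move=> u u' uY u'Y g_uu' reach_uu'; rewrite inE u'Y; apply: (QP u uY).2.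
Qed.

End Conflicts.

Definition level_sweep (g : nat -> V -> nat) (f t : nat) (u : V) (B : {set V}) : Prop :=
  exists t' w, [/\ t' <= f, tour A t u t' w B & g t u <= g t' w].

Section Window.
Variables (lam : nat -> V -> nat) (s l q : nat) (Y : {set V}).
Let f : nat := s + 5 * q * l.
Hypothesis lam_pot : potential A lam.
Hypothesis Y_steady : Y \subset steady lam s f.

Definition level_class (j : nat) : {set V} := [set u in Y | lam s u == j].

Definition level_robust (j k t : nat) (v : V) : Prop :=
  robust A (fun r w => j <= lam r w) (level_class j) q 1 f k t v.

Lemma level_robust_reachable (j k t t' : nat) (v w : V) :
  reachable A t v t' w -> level_robust j k t' w -> level_robust j k t v.
Proof.
apply: robust_reachable => r x r' y xy /leq_trans; apply.
exact: potential_reachable lam_pot xy.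
Qed.

(* Refines lam by the number of vertices of the current level class that can be collected,
   one by one, against an opponent who blocks q of them in each round. *)
Definition level_depth (t : nat) (v : V) : nat :=
  largest_upto q (fun k => level_robust (lam t v) k t v).

Lemma level_depth_sat (t : nat) (v : V) : level_robust (lam t v) (level_depth t v) t v.
Proof. exact: (@largest_upto_sat q (fun k => level_robust (lam t v) k t v) (leqnn _)). Qed.

Lemma level_depth_leq (t : nat) (v : V) : level_depth t v <= q.
Proof. exact: largest_upto_leq. Qed.

Lemma refine_level_depth_potential : potential A (refine q lam level_depth).
Proof.
apply: refine_potential lam_pot level_depth_leq _ => t v w vw eq_lam.
rewrite /level_depth eq_lam; apply: largest_upto_mono => [|k].
  by rewrite /level_robust /= eq_lam.
exact: level_robust_reachable (reachable_step vw).
Qed.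

Lemma level_depth_stuck (t : nat) : s <= t -> t + l <= f ->
  {in Y, forall u, level_depth t u < q} ->
  let phi := refine q lam level_depth in let Y' := Y :&: steady phi t (t + l) in
  {in Y', forall u, exists2 Q : {set V}, #|Q| <= q &
    {in Y', forall u', phi t u = phi t u' -> reachable A t u (t + l) u' ->
      #|[set u'] :\: Q| < 1}}.
Proof.
move=> st tlf shallow /= u /setIP[uY _].
have [Q Qq stuck] := not_robustS (largest_upto_not_succ (shallow u uY)).
exists Q => // u' /setIP[u'Y u'_steady] eq_phi reach_uu'.
have [eq_lam eq_depth] := refine_inj level_depth_leq eq_phi.
move: u'_steady; rewrite inE => /eqP/(refine_inj level_depth_leq)[lam_u' depth_u'].
apply: (stuck (t + l) u' [set u'] tlf).
- by apply: reachable_tour reach_uu' _; apply: tour_wait.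
- rewrite sub1set inE u'Y eq_lam; apply/eqP/esym.
  apply: steady_value lam_pot (subsetP Y_steady _ u'Y) _.
  by rewrite st (leq_trans _ tlf) ?leq_addr.
- rewrite -/(level_depth t u) eq_lam eq_depth -lam_u' -depth_u'; exact: level_depth_sat.
Qed.

Lemma exists_level_robust :
  0 < q -> l <= 2 * E ->
  weighted_drop (degree U) lam s f <= E ->
  (2 * q).+1 * (8 * E) < #|Y| * l ->
  exists2 u, u \in Y & level_robust (lam s u) q s u.
Proof.
move=> q_gt0 l_bound lam_drop Y_large; apply: contrapT => none.
have sf : s <= f by apply: leq_addr.
have lamY u t : u \in Y -> s <= t <= f -> lam t u = lam s u.
  by move/(subsetP Y_steady); apply: steady_value lam_pot.
have shallow t : s <= t <= f -> {in Y, forall u, level_depth t u < q}.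
  move=> stf u uY; rewrite ltn_neqAle level_depth_leq andbT; apply/eqP => depth_u.
  apply: none; exists u => //; have := level_depth_sat t u; rewrite depth_u lamY //.
  by apply: level_robust_reachable; apply: reachable_wait; case/andP: stf.
pose phi := refine q lam level_depth.
have phi_pot : potential A phi := refine_level_depth_potential.
have [||||t [st tlf Y_half phi_drop]] :=
    @exists_quiet_window _ _ phi (degree U) Y s l (5 * q) q (3 * q) phi_pot; rewrite -/f.
- by rewrite muln_gt0.
- by lia.
- move=> u uY; rewrite /phi /refine lamY ?sf ?leqnn // subnDl.
  exact: leq_trans (leq_subr _ _) (level_depth_leq _ _).
- apply: leq_trans (weighted_drop_refine lam_pot level_depth_leq _ sf) _.
  by move: lam_drop; rewrite /degree_sum; nia.
have tl : s <= t <= f by rewrite st (leq_trans _ tlf) ?leq_addr.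
pose Y' := Y :&: steady phi t (t + l).
have : #|Y'| * l <= (2 * q).+1 * (4 * E).
  apply: (stuck_bound phi_pot (subsetIr _ _) l_bound phi_drop
    (B := fun u => [set u]) (h := 1)) (level_depth_stuck st tlf (shallow t tl)).
  move=> Q Qq; apply: leq_trans Qq; apply/subset_leq_card/subsetP=> u.
  by rewrite inE ltnS leqn0 cards_eq0 setD_eq0 sub1set => /andP[].
by move: Y_half; rewrite -/Y'; nia.
Qed.

Lemma exists_level_sweep :
  0 < q -> l <= 2 * E ->
  weighted_drop (degree U) lam s f <= E ->
  (2 * q).+1 * (8 * E) < #|Y| * l ->
  exists u (B : {set V}), [/\ u \in Y, B \subset Y, #|B| = q & level_sweep lam f s u B].
Proof.
move=> q_gt0 l_bound lam_drop Y_large.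
have [u uY u_robust] := exists_level_robust q_gt0 l_bound lam_drop Y_large.
have lam_reachable t v t' w :
    reachable A t v t' w -> lam s u <= lam t' w -> lam s u <= lam t v.
  by move=> vw /leq_trans; apply; apply: potential_reachable lam_pot vw.
have [t' [w [B' [t'f uw B'class level_w]]]] :=
  robust_tour lam_reachable set0 u_robust (leq_addr _ _).
rewrite cards0 set0U muln1 minnn => /exists_subset_card[B BB' Bq].
exists u, B; split=> //.
  by apply/subsetP=> a /(subsetP BB')/(subsetP B'class); rewrite inE => /andP[].
by exists t', w; split=> //; apply: tour_subset uw.
Qed.

End Window.

Lemma exists_sweep_family (g : nat -> V -> nat) (f t h l : nat) (Y : {set V}) :
  potential A g -> 0 < h -> f = t + 5 * (2 * h) * l -> l <= 2 * E ->
  Y \subset steady g t f -> weighted_drop (degree U) g t f <= E ->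
  (4 * h).+1 * (16 * E) < #|Y| * l ->
  exists (F : {set V}) (B : V -> {set V}),
    balanced_family (2 * h) (fun u C => C \subset Y /\ level_sweep g f t u C) Y F B /\
    #|Y| <= 4 * #|F|.
Proof.
move=> g_pot h_gt0 fE l_bound Y_steady g_drop Y_large.
apply: exists_balanced_family => [|Y' Y'Y Y'_half]; first by rewrite muln_gt0.
have Y'_steady := subset_trans Y'Y Y_steady; rewrite fE in g_drop Y'_steady *.
have [||u [B [uY' BY' B_card sweep]]] :=
    exists_level_sweep g_pot Y'_steady _ l_bound g_drop.
- by rewrite muln_gt0.
- by move: Y_large Y'_half; nia.
by exists u, B; do 2!split=> //; apply: subset_trans BY' Y'Y.
Qed.

Section RobustLevels.
Variables (X : {set V}) (m h H f : nat).
Hypothesis h_gt0 : 0 < h.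

Local Notation robust_freely := (robust A (fun _ _ => True) X m h f).

Definition robust_level (t : nat) (v : V) : nat :=
  largest_upto H (fun j => robust_freely j t v).

Lemma robust_level_sat (t : nat) (v : V) : robust_freely (robust_level t v) t v.
Proof. exact: (@largest_upto_sat H (fun j => robust_freely j t v)). Qed.

Lemma robust_level_potential : potential A robust_level.
Proof.
move=> t v w vw; apply: largest_upto_mono => // j.
by apply: robust_reachable (reachable_step vw).
Qed.

Lemma balanced_sweeps_bound (t l r : nat) (Y F : {set V}) (B : V -> {set V}) :
  l <= 2 * E -> r <= f -> Y \subset X -> Y \subset steady robust_level t (t + l) ->
  weighted_drop (degree U) robust_level t (t + l) <= E ->
  (forall u, robust_level t u < H) ->
  balanced_family (2 * h)
    (fun u C => C \subset Y /\ level_sweep robust_level r (t + l) u C) Y F B ->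
  #|F| * l <= (4 * m).+1 * (4 * E).
Proof.
move=> l_bound rf YX Y_steady g_drop below [FY sweeps loadF].
have F_steady := subset_trans FY Y_steady.
have spoiled (Q : {set V}) : #|Q| <= m -> #|[set u in F | #|B u :\: Q| < h]| <= 2 * m.
  move=> Qm; rewrite -(leq_pmul2r h_gt0) [2 * m]mulnC -mulnA.
  by apply: card_spoiled loadF Qm => u /sweeps[_ ->]; rewrite mul2n addnn.
rewrite -[4 * m](mulnA 2 2 m).
apply: (stuck_bound robust_level_potential F_steady l_bound g_drop spoiled) => u uF.
have [Q Qm stuck] := not_robustS (largest_upto_not_succ (below u)).
exists Q => // u' u'F eq_level reach_uu'.
have [[BY [t' [w [t'r tour_w level_w]]]] _] := sweeps u' u'F.
apply: stuck (leq_trans t'r rf) (reachable_tour reach_uu' tour_w) (subset_trans BY YX) _.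
apply: robust_leq (robust_level_sat t' w) => //; apply: leq_trans level_w.
rewrite -/(robust_level t u) eq_level.
by move: (subsetP F_steady _ u'F); rewrite inE => /eqP->.
Qed.

(* In the second part of the window many vertices can sweep, within their level, sets of
   vertices with few overlaps; in the first part the opponent cannot block all of these
   sweeps. *)
Lemma steady_robust_level_bound (t l1 l2 : nat) (Y : {set V})
    (r := t + l1 + 5 * (2 * h) * l2) :
  r <= f -> l1 <= 2 * E -> l2 <= 2 * E ->
  Y \subset X -> Y \subset steady robust_level t r ->
  weighted_drop (degree U) robust_level t r <= E -> (forall u, robust_level t u < H) ->
  (4 * h).+1 * (16 * E) < #|Y| * l2 -> #|Y| * l1 <= (4 * m).+1 * (16 * E).
Proof.
move=> rf l1_bound l2_bound YX Y_steady g_drop below Y_large.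
have tl1 : t <= t + l1 by apply: leq_addr.
have l1r : t + l1 <= r by apply: leq_addr.
have pot := robust_level_potential.
have Y_steady1 := subset_trans Y_steady (steady_subwindow pot (leqnn t) tl1 l1r).
have Y_steady2 := subset_trans Y_steady (steady_subwindow pot tl1 l1r (leqnn r)).
have g_drop1 := leq_trans (weighted_drop_subwindow _ pot (leqnn t) l1r) g_drop.
have g_drop2 := leq_trans (weighted_drop_subwindow _ pot tl1 (leqnn r)) g_drop.
have [F [B [family F_large]]] :=
  exists_sweep_family pot h_gt0 (erefl r) l2_bound Y_steady2 g_drop2 Y_large.
have := balanced_sweeps_bound l1_bound rf YX Y_steady1 g_drop1 below family.
by move: F_large; nia.
Qed.

End RobustLevels.

Lemma exists_robust (X : {set V}) (m h H s l1 l2 : nat) :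
  0 < h -> 0 < H -> l1 <= 2 * E -> l2 <= 2 * E ->
  32 * ((4 * m).+1 * E) < #|X| * l1 -> 32 * ((4 * h).+1 * E) < #|X| * l2 ->
  exists v, robust A (fun _ _ => True) X m h (s + 3 * H * (l1 + 10 * h * l2)) H s v.
Proof.
move=> h_gt0 H_gt0 l1_bound l2_bound X_large1 X_large2.
set l := l1 + _; set f := s + _; apply: contrapT => none.
pose g := robust_level X m h H f.
have g_pot : potential A g := robust_level_potential X m h H f.
have drop_leq t u : g s u - g t u <= H.
  exact: leq_trans (leq_subr _ _) (largest_upto_leq _ _).
have [||||t [st tlf X_half g_drop]] :=
    @exists_quiet_window _ _ g (degree U) X s l (3 * H) H H g_pot; rewrite -/f //.
- by rewrite muln_gt0.
- by lia.
- rewrite big_distrr; apply: leq_sum => w _.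
  by rewrite mulnC leq_mul2r drop_leq orbT.
have below u : g t u < H.
  rewrite ltn_neqAle largest_upto_leq andbT; apply/eqP => gH.
  apply: none; exists u; have := robust_level_sat X m h H f t u.
  rewrite -/(g t u) gH; apply: robust_reachable => //; exact: reachable_wait.
pose Y := X :&: steady g t (t + l).
have tl : t + l = t + l1 + 5 * (2 * h) * l2 by rewrite /l; lia.
have Y_large : (4 * h).+1 * (16 * E) < #|Y| * l2 by move: X_half X_large2; rewrite -/Y; nia.
have YX : Y \subset X := subsetIl _ _.
have Y_steady : Y \subset steady g t (t + l) := subsetIr _ _.
rewrite tl in tlf Y_steady g_drop.
have := steady_robust_level_bound h_gt0 tlf l1_bound l2_bound YX Y_steady g_drop below
  Y_large.
by move: X_half X_large1; rewrite -/Y; nia.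
Qed.

(** * Exploration by phases *)

Lemma card_leq_degree_sum : 1 < #|V| -> #|V| <= E.
Proof.
move=> V_gt1; rewrite -sum1_card; apply: leq_sum => v _.
have [u uv] : exists u, u \notin [set v].
  have: 0 < #|~: [set v]| by rewrite cardsCs setCK cards1 subn_gt0.
  by case/card_gt0P=> u; rewrite inE; exists u.
have [_ [w [/set1P-> _ vw]]] := connect_crossing (A_conn 0 v u) (set11 v) uv.
by apply/card_gt0P; exists w; rewrite inE; apply: A_sub vw.
Qed.

Definition reached (s : nat) (u : V) (d : nat) : {set V} :=
  [set w | `[< reachable A s u (s + d) w >]].

Lemma card_reached (s : nat) (u : V) (d : nat) : minn d.+1 #|V| <= #|reached s u d|.
Proof.
have in_reached k : u \in reached s u k.
  by rewrite inE; apply/asboolP/reachable_wait/leq_addr.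
elim: d => [|d IH]; first by rewrite geq_min; apply/orP; left; apply/card_gt0P; exists u.
have grow w k : w \in reached s u d -> (k == w) || A (s + d) w k -> k \in reached s u d.+1.
  rewrite !inE addnS => /asboolP uw /reachable_step wk; apply/asboolP.
  exact: reachable_trans uw wk.
have sub : reached s u d \subset reached s u d.+1.
  by apply/subsetP=> w /grow; apply; rewrite eqxx.
have [full | [y]] := set_0Vmem (~: reached s u d).
  rewrite geq_min (_ : reached s u d.+1 = setT) ?cardsT ?leqnn ?orbT //.
  by apply/eqP; rewrite -subTset; apply: subset_trans sub; rewrite -setCS full sub0set.
rewrite inE => y_new.
have [k [w [k_old w_new kw]]] := connect_crossing (A_conn (s + d) u y) (in_reached d) y_new.
have : w |: reached s u d \subset reached s u d.+1.
  by rewrite subUset sub andbT sub1set; apply: grow k_old _; rewrite kw orbT.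
by move/subset_leq_card; rewrite cardsU1 w_new; lia.
Qed.

Lemma reachable_after_card (s : nat) (u v : V) : reachable A s u (s + #|V|) v.
Proof.
have full : reached s u #|V| = setT.
  by apply/eqP; rewrite eqEcard subsetT cardsT; have := card_reached s u #|V|; lia.
have: v \in reached s u #|V| by rewrite full inE.
by rewrite inE => /asboolP.
Qed.

Section Phases.
Variable c : nat.
Hypothesis c_large : 200 * 100 <= c.

Lemma exists_collecting_tour (X : {set V}) (h s : nat) :
  0 < h -> #|V| <= E -> c * h ^ 3 <= #|X| ->
  exists u w (B : {set V}), [/\ tour A s u (s + E) w B, B \subset X & h ^ 2 <= #|B|].
Proof.
move=> h_gt0 V_leq_E hX.
have X_large : 200 * 100 * h ^ 3 <= #|X|.
  by apply: leq_trans hX; rewrite leq_mul2r c_large orbT.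
have [l1 [l2 [l1_bound l2_bound X_large1 X_large2 time_leq]]] :=
  exists_window_lengths h_gt0 X_large (leq_trans (max_card _) V_leq_E).
have [v v_robust] := exists_robust s h_gt0 h_gt0 l1_bound l2_bound X_large1 X_large2.
have [t [w [B [tf vw BX _]]]] :=
  robust_tour (fun _ _ _ _ _ _ => I) set0 v_robust (leq_addr _ _).
rewrite cards0 set0U mulnn minnn => B_large; exists v, w, B; split=> //.
by apply: tour_extend vw _; rewrite (leq_trans tf) ?leq_add2l.
Qed.

Lemma exists_collecting_tour_from (X : {set V}) (h s : nat) (u : V) :
  0 < #|X| -> #|V| <= E -> c * h ^ 3 <= #|X| ->
  exists w (B : {set V}),
    [/\ tour A s u (s + 2 * E) w B, B \subset X & maxn 1 (h ^ 2) <= #|B|].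
Proof.
move=> X_gt0 V_leq_E hX; pose t := s + E.
have go v : reachable A s u t v.
  by apply: tour_extend (reachable_after_card s u v) _; rewrite leq_add2l.
have -> : s + 2 * E = t + E by rewrite /t; lia.
have [h_eq0|h_gt0] := posnP h.
  have [x xX] := card_gt0P X_gt0; exists x, [set x]; rewrite sub1set xX cards1 h_eq0.
  by split=> //; apply: reachable_tour (go x) (tour_wait _ _ (leq_addr _ _)).
have [v [w [B [vw BX B_large]]]] := exists_collecting_tour t h_gt0 V_leq_E hX.
exists w, B; split=> //; first exact: reachable_tour (go v) vw.
by rewrite (maxn_idPr _) ?expn_gt0 ?h_gt0.
Qed.

Lemma exploring_tour_gt1 (p s : nat) (u : V) (X : {set V}) :
  1 < #|V| -> phase_factor c * #|X| <= p ^ 3 ->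
  exists w, tour A s u (s + p * (2 * E)) w X.
Proof.
move=> V_gt1; have c_gt0 : 0 < c by apply: leq_trans c_large.
elim: p s u X => [|p IH] s u X X_bound.
  exists u; suff -> : X = set0 by apply: reachable_wait; apply: leq_addr.
  apply/cards0_eq/eqP; move: X_bound.
  by rewrite exp0n // leqn0 muln_eq0 gtn_eqF // phase_factor_gt0.
have phase w (B : {set V}) :
    tour A s u (s + 2 * E) w B -> phase_factor c * #|X :\: B| <= p ^ 3 ->
    exists w', tour A s u (s + p.+1 * (2 * E)) w' X.
  move=> uw /(IH (s + 2 * E) w)[w' ww']; exists w'; rewrite mulSn addnA.
  by apply: tour_subset (tour_cat uw ww'); rewrite -subDset.
have [X_small | X_big] := leqP (phase_factor c * #|X|) (p ^ 3).
  by apply: (phase u set0); rewrite ?setD0 //; apply: reachable_wait; apply: leq_addr.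
have X_gt0 : 0 < #|X| by rewrite lt0n; apply: contraTneq X_big => ->; rewrite muln0.
have [h /andP[hX Xh]] := exists_floor_root #|X| c_gt0 (isT : 0 < 3).
have [w [B [uw BX]]] :=
  exists_collecting_tour_from s u X_gt0 (card_leq_degree_sum V_gt1) hX.
rewrite geq_max => /andP[B_gt0 hB]; apply: phase uw _; rewrite cardsDS //.
by apply: phase_factor_decrease B_gt0 hB Xh _; rewrite X_big.
Qed.

Lemma exploring_tour (p s : nat) (u : V) (X : {set V}) :
  phase_factor c * #|X| <= p ^ 3 -> exists w, tour A s u (s + p * (2 * E)) w X.
Proof.
have [V_leq1 _ | V_gt1] := leqP #|V| 1; last exact: exploring_tour_gt1.
have Xu : X \subset [set u] by apply/subsetP=> x _; apply/set1P/(card_le1_eqP V_leq1).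
by exists u; apply: tour_subset Xu (tour_wait _ _ _); apply: leq_addr.
Qed.

End Phases.

End AlwaysConnected.

(** * From routes to temporal walks *)

Section TemporalWalkOfRoute.
Variables (V : finType) (T : nat) (G : tgraph V T.+1).

Definition snapshot (t : nat) : rel V := adj (G (inord t)).

Lemma snapshot_sym (t : nat) : symmetric (snapshot t).
Proof. exact: adj_sym. Qed.

Lemma snapshot_connected :
  always_connected G -> forall (t : nat) (x y : V), connect (snapshot t) x y.
Proof. by move=> conn t; apply: conn (inord t). Qed.

Lemma snapshot_underlying (t : nat) : subrel (snapshot t) (adj (underlying G)).
Proof. by move=> x y xy; apply/existsP; exists (inord t). Qed.

Fixpoint moves (s : nat) (u : V) (p : seq V) : seq (tstep V T.+1) :=
  if p is v :: p' then
    if v == u then moves s.+1 v p' else ((u, v), inord s) :: moves s.+1 v p'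
  else [::].

Lemma moves_time (s : nat) (u : V) (p : seq V) : s + size p <= T.+1 ->
  {in moves s u p, forall x : tstep V T.+1, s <= x.2 < s + size p}.
Proof.
elim: p s u => // v p IH s u; rewrite /= -addSnnS => sT x.
have later : x \in moves s.+1 v p -> s <= x.2 < s.+1 + size p.
  by move=> /(IH _ _ sT)/andP[/ltnW-> ->].
case: eqP => // _; rewrite inE => /orP[/eqP-> | //] /=.
by rewrite inordK; lia.
Qed.

Lemma moves_temporal_walk (s : nat) (u : V) (p : seq V) : s + size p <= T.+1 ->
  route snapshot s u p -> temporal_walk G u (moves s u p).
Proof.
elim: p s u => [|v p IH] s u; first by rewrite /temporal_walk /= eqxx.
rewrite /= -addSnnS => sT /andP[uv /(IH _ _ sT) walk].
case: eqP uv walk => [-> // | _ /= uv] /and3P[adjs ordered starts].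
rewrite /temporal_walk /= [adj _ _ _]uv adjs eqxx andbT /=.
have := moves_time sT (u := v).
case: (moves s.+1 v p) ordered starts => //= y w -> yv times.
have /andP[sy _] := times y (mem_head _ _).
by rewrite eq_sym yv inordK //; lia.
Qed.

Lemma moves_visited (s : nat) (u : V) (p : seq V) :
  {subset u :: p <= visited u (moves s u p)}.
Proof.
elim: p s u => [|v p IH] s u a; first exact.
rewrite in_cons => /orP[/eqP-> | /(IH s.+1 v)].
  exact: mem_head.
by rewrite /=; case: eqP => [-> // | _ av]; rewrite /visited /= in_cons av orbT.
Qed.

Lemma tour_explorable (b : nat) (start : 'I_b -> V) (agent : 'I_b) (w : V)
    (k : nat) (l : int) :
  tour snapshot 0 (start agent) k w [set: V] -> k <= T.+1 -> (k%:Z <= l)%R ->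
  explorable_within G start l.
Proof.
move=> [p [p_route <- _ p_all]] pT pl.
exists (fun i => if i == agent then moves 0 (start agent) p else [::]); split.
- move=> i; case: eqP => [-> | _]; first exact: moves_temporal_walk p_route.
  by rewrite /temporal_walk /= eqxx.
- move=> i x; case: eqP => // _ /(moves_time pT)/andP[_ xp].
  exact: le_trans pl.
- by move=> v; exists agent; rewrite eqxx; apply/moves_visited/p_all; rewrite inE.
Qed.

End TemporalWalkOfRoute.

(** * The exploration bound *)

Local Open Scope ring_scope.

Section ExplorationBound.
Variables (R : realType) (n r b : nat).
Hypotheses (n_gt0 : (0 < n)%N) (r_gt1 : (1 < r)%N) (b_gt0 : (0 < b)%N).

Lemma exploration_bound_gt0 (D : R) : 0 < exploration_bound n r b D.
Proof.
apply: ltr_wpDl; last by rewrite divr_gt0 ?exprn_gt0 ?ltr0n // ltnW.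
by rewrite !mulr_ge0 ?exprn_ge0 ?powR_ge0.
Qed.

Lemma powR_half_sqr (x : R) (k : nat) : 0 <= x -> (x `^ (k%:R / 2)) ^+ 2 = x ^+ k.
Proof.
by move=> x_ge0; rewrite -powR_mulrn ?powR_ge0 // -powRrM divfK ?powR_mulrn.
Qed.

Lemma sqr_mul_le_cube (x y : R) : 0 <= x -> 0 <= y -> x ^+ 2 * y <= (x + y) ^+ 3.
Proof.
move=> x_ge0 y_ge0; rewrite [in leRHS]exprSr.
apply: ler_pM; rewrite ?exprn_ge0 ?lerDr //.
by rewrite lerXn2r ?nnegrE ?addr_ge0 ?lerDl.
Qed.

Lemma exploration_bound_cube (D : R) : 0 <= D ->
  ln 2 ^+ 3 * (n%:R ^+ 4 * D ^+ 3) <= exploration_bound n r b D ^+ 3.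
Proof.
move=> D_ge0; have r_gt0 : (0 : R) < r%:R by rewrite ltr0n ltnW.
have ln2_gt0 : (0 : R) < ln 2 by rewrite ln_gt0 // ltr1n.
have ln2_leq_lnr : ln 2 <= ln r%:R :> R by rewrite ler_ln ?posrE // ler_nat.
have lnr_ge0 := le_trans (ltW ln2_gt0) ln2_leq_lnr.
apply: le_trans (sqr_mul_le_cube _ _); last first.
- by rewrite divr_ge0 ?exprn_ge0.
- by rewrite !mulr_ge0 ?exprn_ge0 ?powR_ge0.
rewrite 4!exprMn (powR_half_sqr 1) ?(powR_half_sqr 3) ?(ltW r_gt0) //.
have -> : n%:R ^+ 2 * r%:R ^+ 1 * b%:R ^+ 3 ^+ 2 * D ^+ 3 * ln r%:R ^+ 3 *
    (n%:R ^+ 2 / r%:R) = (b%:R ^+ 3 ^+ 2 * ln r%:R ^+ 3) * (n%:R ^+ 4 * D ^+ 3).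
  by field; rewrite gt_eqF.
rewrite ler_wpM2r ?mulr_ge0 ?exprn_ge0 // -[X in X <= _]mul1r.
apply: ler_pM; rewrite ?exprn_ge0 ?(ltW ln2_gt0) ?exprn_ege1 ?ler1n //.
by rewrite lerXn2r ?nnegrE ?(ltW ln2_gt0).
Qed.

Lemma exploration_time_leq (K p E : nat) : (0 < K)%N -> (p ^ 3 <= 8 * (K * n))%N ->
  (p * (2 * E))%:R <= 4 * K%:R / ln 2 * exploration_bound n r b (E%:R / n%:R : R).
Proof.
move=> K_gt0 p_leq; set f := exploration_bound _ _ _ _.
have ln2_gt0 : (0 : R) < ln 2 by rewrite ln_gt0 // ltr1n.
have C_ge0 : 0 <= 4 * K%:R / ln 2 :> R by rewrite divr_ge0 // ltW.
have f_ge0 : 0 <= f by apply/ltW/exploration_bound_gt0.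
rewrite -(@ler_pXn2r _ 3) ?nnegrE ?(mulr_ge0 C_ge0 f_ge0) //.
have p3_leq : (8 * p ^ 3 <= (4 * K) ^ 3 * n)%N.
  have K_leq_cube : (K <= K ^ 3)%N by rewrite -{1}[K]expn1 leq_pexp2l.
  apply: leq_trans (leq_mul (leqnn 8) p_leq) _; rewrite expnMn !mulnA leq_mul2r.
  by apply/orP; right; lia.
apply: (@le_trans _ _ ((4 * K%:R) ^+ 3 * (n%:R * E%:R ^+ 3))).
  have -> : (p * (2 * E))%:R ^+ 3 = 8 * p%:R ^+ 3 * E%:R ^+ 3 :> R by rewrite !natrM; ring.
  rewrite mulrA ler_wpM2r ?exprn_ge0 //.
  by move: p3_leq; rewrite -(ler_nat R) !(natrM, natrX).
rewrite [in leRHS]exprMn expr_div_n -[leRHS]mulrA ler_wpM2l ?exprn_ge0 ?mulr_ge0 //.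
rewrite [leRHS]mulrC ler_pdivlMr ?exprn_gt0 //.
have <- : n%:R ^+ 4 * (E%:R / n%:R) ^+ 3 = n%:R * E%:R ^+ 3 :> R.
  by field; rewrite gt_eqF ?ltr0n.
by rewrite mulrC exploration_bound_cube // divr_ge0.
Qed.

End ExplorationBound.

Theorem theorem3 (R : realType) (c : R) (hc : 0 < c) :
  exists2 C : R, 0 < C &
    forall (V : finType) (T : nat) (G : tgraph V T) (r b : nat),
      always_connected G ->
      (2 <= r)%N -> (1 <= b)%N ->
      (exists S : {set V}, strict_division c (underlying G) r b S) ->
      let f := exploration_bound #|V| r b (average_degree R (underlying G)) in
      C * f <= T%:R ->
      forall start : 'I_b -> V,
        explorable_within G start (Num.ceil (C * f)).
Proof.
(* The numeral is hidden behind a, since phase_factor must not be evaluated in unary. *)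
have [a a_large] : exists a, (200 * 100 <= a)%N by exists (200 * 100)%N.
have K_gt0 : (0 < phase_factor a)%N by apply: phase_factor_gt0; apply: leq_trans a_large.
have C_gt0 : (0 : R) < 4 * (phase_factor a)%:R / ln 2.
  by rewrite divr_gt0 ?mulr_gt0 ?ltr0n // ln_gt0 // ltr1n.
exists (4 * (phase_factor a)%:R / ln 2) => // V T G r b conn r_gt1 b_gt0 _ f fT start.
pose agent : 'I_b := Ordinal b_gt0.
have V_gt0 : (0 < #|V|)%N by apply/card_gt0P; exists (start agent).
have f_gt0 : 0 < f by apply: exploration_bound_gt0.
case: T G conn @f fT f_gt0 => [|T] G conn f fT f_gt0.
  by move: fT; rewrite leNgt mulr_gt0.
have [|p /andP[p_geq p_leq]] := @exists_ceil_root 3 (phase_factor a * #|V|) isT.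
  by rewrite muln_gt0 K_gt0.
rewrite -cardsT in p_geq.
have [w w_tour] := exploring_tour (snapshot_sym G) (snapshot_connected conn)
  (@snapshot_underlying _ _ G) a_large 0 (start agent) p_geq.
have time_leq :
    (p * (2 * degree_sum (underlying G)))%:R <= 4 * (phase_factor a)%:R / ln 2 * f.
  exact: exploration_time_leq.
apply: tour_explorable w_tour _ _.
  by rewrite -(ler_nat R); apply: le_trans time_leq fT.
by rewrite -(ler_int R); apply: le_trans time_leq (ceil_ge _).
Qed.
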